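(* If $G\in\mathcal{P}^*$, then the pro-nilpotent completion $\hat G_{nil}$ is locally polycyclic (that is, every finitely generated subgroup of $\hat G_{nil}$ is polycyclic).
   Context: $\mathcal{P}^*$ is the class of polycyclic groups $G$ which are residually nilpotent ($\bigcap_i\gamma_i(G)=1$) and nilpotent-by-abelian (i.e. the derived subgroup $G'$ is nilpotent). Here $\gamma_1(G)=G$, $\gamma_{i+1}(G)=[\gamma_i(G),G]$ is the lower central series. The pro-nilpotent completion of $G$ is the (abstract) group $\hat G_{nil}=\varprojlim_i G/\gamma_i(G)$, the inverse limit of the lower central quotients. *)

(* Defs.v *)
From HB Require Import structures.
From mathcomp Require Import all_boot.
From mathcomp Require Import boolp classical_sets cardinality.

Set Implicit Arguments.
Unset Strict Implicit.
Unset Printing Implicit Defensive.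

Local Open Scope classical_set_scope.
Local Open Scope quotient_scope.
Local Open Scope group_scope.

Definition is_subgroup (G : groupType) (H : set G) : Prop :=
  [/\ H 1, forall x y, H x -> H y -> H (x * y) & forall x, H x -> H x^-1].

Definition is_normal_in (G : groupType) (N H : set G) : Prop :=
  [/\ is_subgroup N, N `<=` H & forall x y, N x -> H y -> N (x ^ y)].

Definition gen (G : groupType) (A : set G) : set G := smallest (@is_subgroup G) A.

Definition finitely_generated (G : groupType) (H : set G) : Prop :=
  exists2 A : set G, finite_set A & H = gen A.

Definition commutator (G : groupType) (A B : set G) : set G :=
  gen [set z | exists x y, [/\ A x, B y & z = [~ x, y]]].

(* [lcs H n] is gamma_(n+1)(H): the index is shifted by one. *)
Fixpoint lcs (G : groupType) (H : set G) (n : nat) : set G :=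
  if n is m.+1 then commutator (lcs H m) H else H.

Definition nilpotent (G : groupType) (H : set G) : Prop :=
  exists n, lcs H n = [set 1].

Definition residually_nilpotent (G : groupType) : Prop :=
  \bigcap_n lcs [set: G] n = [set 1].

Definition derived (G : groupType) : set G := commutator [set: G] [set: G].
Arguments derived : clear implicits.

Definition nilpotent_by_abelian (G : groupType) : Prop := nilpotent (derived G).

(* For N normal in H, the quotient H / N is the cyclic group generated by the
   coset of some g in H: each coset of N in H contains a power of g. *)
Definition cyclic_quotient (G : groupType) (H N : set G) : Prop :=
  exists2 g, H g &
    forall x, H x -> exists2 h, gen [set g] h & N (h^-1 * x).

Definition polycyclic (G : groupType) (H : set G) : Prop :=
  exists (n : nat) (S : nat -> set G),
    [/\ S 0%N = [set 1], S n = H, is_subgroup H &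
        forall i, (i < n)%N ->
          is_normal_in (S i) (S i.+1) /\ cyclic_quotient (S i.+1) (S i)].

Definition locally_polycyclic (G : groupType) : Prop :=
  forall H : set G, is_subgroup H -> finitely_generated H -> polycyclic H.

Definition Pstar (G : groupType) : Prop :=
  [/\ polycyclic [set: G], residually_nilpotent G & nilpotent_by_abelian G].

Record normal_subgroup (G : groupType) := NormalSubgroup {
  nsub_set :> G -> Prop;
  nsubP : is_normal_in nsub_set [set: G] }.

Lemma nsub1 (G : groupType) (N : normal_subgroup G) : N 1.
Proof. by case: (nsubP N) => -[]. Qed.

Lemma nsubM (G : groupType) (N : normal_subgroup G) x y :
  N x -> N y -> N (x * y).
Proof. by case: (nsubP N) => -[_ h _] _ _; apply: h. Qed.

Lemma nsubV (G : groupType) (N : normal_subgroup G) x : N x -> N x^-1.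
Proof. by case: (nsubP N) => -[_ _ h] _ _; apply: h. Qed.

Lemma nsubJ (G : groupType) (N : normal_subgroup G) x y : N x -> N (x ^ y).
Proof. by case: (nsubP N) => _ _ h Nx; apply: h. Qed.

Definition coset_rel (G : groupType) (N : normal_subgroup G) : rel G :=
  fun x y => `[< N (x^-1 * y) >].

Lemma coset_rel_refl (G : groupType) (N : normal_subgroup G) :
  reflexive (coset_rel N).
Proof. by move=> x; apply/asboolP; rewrite mulVg; exact: nsub1. Qed.

Lemma coset_rel_sym (G : groupType) (N : normal_subgroup G) :
  symmetric (coset_rel N).
Proof.
have h x y : coset_rel N x y -> coset_rel N y x.
  by move=> /asboolP /nsubV Nxy; apply/asboolP; rewrite invgM invgK in Nxy.
by move=> x y; apply/idP/idP; apply: h.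
Qed.

Lemma coset_rel_trans (G : groupType) (N : normal_subgroup G) :
  transitive (coset_rel N).
Proof.
move=> y x z /asboolP Nxy /asboolP Nyz; apply/asboolP.
by have := nsubM Nxy Nyz; rewrite -mulgA mulVKg.
Qed.

Canonical coset_equiv (G : groupType) (N : normal_subgroup G) :=
  EquivRel (coset_rel N) (@coset_rel_refl G N) (@coset_rel_sym G N)
    (@coset_rel_trans G N).

Definition quotient_group (G : groupType) (N : normal_subgroup G) :=
  {eq_quot coset_rel N}.

HB.instance Definition _ (G : groupType) (N : normal_subgroup G) :=
  Choice.on (quotient_group N).
HB.instance Definition _ (G : groupType) (N : normal_subgroup G) :=
  EqQuotient.on (quotient_group N).

Definition coset (G : groupType) (N : normal_subgroup G) (x : G) :
  quotient_group N := \pi x.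

Lemma coset_eqP (G : groupType) (N : normal_subgroup G) (x y : G) :
  coset N x = coset N y <-> N (x^-1 * y).
Proof.
split=> [/eqquotP /asboolP //|Nxy]; apply/eqquotP; exact/asboolP.
Qed.

Lemma coset_repr (G : groupType) (N : normal_subgroup G)
  (q : quotient_group N) : coset N (repr q) = q.
Proof. exact: reprK. Qed.

Definition quotient_mul (G : groupType) (N : normal_subgroup G)
  (p q : quotient_group N) : quotient_group N := coset N (repr p * repr q).

Definition quotient_one (G : groupType) (N : normal_subgroup G) :
  quotient_group N := coset N 1.

Definition quotient_inv (G : groupType) (N : normal_subgroup G)
  (p : quotient_group N) : quotient_group N := coset N (repr p)^-1.

Lemma quotient_mulE (G : groupType) (N : normal_subgroup G) (x y : G) :
  quotient_mul (coset N x) (coset N y) = coset N (x * y).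
Proof.
apply/coset_eqP; set a := repr _; set b := repr _.
have Na : N (a^-1 * x) by apply/coset_eqP; rewrite coset_repr.
have Nb : N (b^-1 * y) by apply/coset_eqP; rewrite coset_repr.
have := nsubM Nb (nsubJ y Na).
by rewrite conjgE invgM -!mulgA mulVKg.
Qed.

Lemma quotient_invE (G : groupType) (N : normal_subgroup G) (x : G) :
  quotient_inv (coset N x) = coset N x^-1.
Proof.
apply/coset_eqP; set a := repr _.
have Na : N (x^-1 * a) by apply/coset_eqP; rewrite coset_repr.
by have := nsubJ x^-1 Na; rewrite conjgE !invgK mulgA mulVKg.
Qed.

Lemma quotient_mulA (G : groupType) (N : normal_subgroup G) :
  associative (@quotient_mul G N).
Proof.
move=> p q r; rewrite -(coset_repr p) -(coset_repr q) -(coset_repr r).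
by rewrite !quotient_mulE mulgA.
Qed.

Lemma quotient_mul1q (G : groupType) (N : normal_subgroup G) :
  left_id (quotient_one N) (@quotient_mul G N).
Proof. by move=> p; rewrite -(coset_repr p) quotient_mulE mul1g. Qed.

Lemma quotient_mulq1 (G : groupType) (N : normal_subgroup G) :
  right_id (quotient_one N) (@quotient_mul G N).
Proof. by move=> p; rewrite -(coset_repr p) quotient_mulE mulg1. Qed.

Lemma quotient_mulVq (G : groupType) (N : normal_subgroup G) :
  left_inverse (quotient_one N) (@quotient_inv G N) (@quotient_mul G N).
Proof.
by move=> p; rewrite -(coset_repr p) quotient_invE quotient_mulE mulVg.
Qed.

Lemma quotient_mulqV (G : groupType) (N : normal_subgroup G) :
  right_inverse (quotient_one N) (@quotient_inv G N) (@quotient_mul G N).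
Proof.
by move=> p; rewrite -(coset_repr p) quotient_invE quotient_mulE mulgV.
Qed.

HB.instance Definition _ (G : groupType) (N : normal_subgroup G) :=
  isGroup.Build (quotient_group N) (@quotient_mulA G N) (@quotient_mul1q G N)
    (@quotient_mulq1 G N) (@quotient_mulVq G N) (@quotient_mulqV G N).

Lemma cosetM (G : groupType) (N : normal_subgroup G) :
  {morph coset N : x y / x * y}.
Proof. by move=> x y; rewrite -quotient_mulE. Qed.

(* When N is contained in M, this is the canonical map G / N -> G / M. *)
Definition quotient_map (G : groupType) (N M : normal_subgroup G)
  (q : quotient_group N) : quotient_group M := coset M (repr q).

Lemma quotient_mapE (G : groupType) (N M : normal_subgroup G) (x : G) :
  N `<=` M -> quotient_map M (coset N x) = coset M x.
Proof.
by move=> NM; apply/coset_eqP/NM/coset_eqP; rewrite coset_repr.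
Qed.

Lemma quotient_mapM (G : groupType) (N M : normal_subgroup G) :
  N `<=` M -> {morph @quotient_map G N M : p q / p * q}.
Proof.
move=> NM p q; rewrite -(coset_repr p) -(coset_repr q) -cosetM.
by rewrite !quotient_mapE // cosetM.
Qed.

Lemma gen_subgroup (G : groupType) (A : set G) : is_subgroup (gen A).
Proof.
split=> [|x y Ax Ay|x Ax] B [sB AB].
- by case: sB.
- by have [_ h _] := sB; apply: h; [apply: Ax|apply: Ay].
- by have [_ _ h] := sB; apply: h; apply: Ax.
Qed.

Lemma gen_conj (G : groupType) (A : set G) (y : G) :
  (forall x, A x -> A (x ^ y)) -> forall x, gen A x -> gen A (x ^ y).
Proof.
move=> AJ x; have [g1 gM gV] := gen_subgroup A.
apply: (@smallest_sub _ _ _ [set x | gen A (x ^ y)]).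
  split=> [|u v|u] /=; first by rewrite conj1g.
    by rewrite conjMg; apply: gM.
  by rewrite conjVg; apply: gV.
by move=> u Au; apply: sub_gen_smallest; apply: AJ.
Qed.

Lemma lcs_subgroup (G : groupType) (n : nat) : is_subgroup (lcs [set: G] n).
Proof. by case: n => [//|n]; apply: gen_subgroup. Qed.

Lemma lcs_conj (G : groupType) (n : nat) (x y : G) :
  lcs [set: G] n x -> lcs [set: G] n (x ^ y).
Proof.
elim: n x => [//|n IHn] x; apply: gen_conj => _ [a [b [La _ ->]]].
by exists (a ^ y), (b ^ y); split; [apply: IHn| |rewrite conjRg].
Qed.

Lemma lcs_normal (G : groupType) (n : nat) :
  is_normal_in (lcs [set: G] n) [set: G].
Proof.
by split; [apply: lcs_subgroup| |move=> x y Lx _; apply: lcs_conj].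
Qed.

(* [gamma G n] is gamma_(n+1)(G), by the same shift of index as in [lcs]. *)
Definition gamma (G : groupType) (n : nat) : normal_subgroup G :=
  NormalSubgroup (lcs_normal G n).

Lemma gammaS (G : groupType) (n : nat) : gamma G n.+1 `<=` gamma G n.
Proof.
apply: smallest_sub; first exact: lcs_subgroup.
move=> _ [x [y [Lx _ ->]]]; rewrite commgEl.
by apply: (@nsubM _ (gamma G n)); [apply: nsubV|apply: nsubJ].
Qed.

Definition is_compatible (G : groupType)
    (q : forall n, quotient_group (gamma G n)) : Prop :=
  forall n, quotient_map (gamma G n) (q n.+1) = q n.

Definition pronilpotent_completion (G : groupType) :=
  {q : forall n, quotient_group (gamma G n) | `[< is_compatible q >]}.

HB.instance Definition _ (G : groupType) :=
  Choice.on (pronilpotent_completion G).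

Definition component (G : groupType) (q : pronilpotent_completion G) (n : nat) :
  quotient_group (gamma G n) := val q n.

Lemma componentP (G : groupType) (q : pronilpotent_completion G) (n : nat) :
  quotient_map (gamma G n) (component q n.+1) = component q n.
Proof. by move: (valP q) => /asboolP; apply. Qed.

Lemma completion_eq (G : groupType) (p q : pronilpotent_completion G) :
  (forall n, component p n = component q n) -> p = q.
Proof. by move=> pq; apply/val_inj/functional_extensionality_dep. Qed.

Lemma completion_mul_subproof (G : groupType) (p q : pronilpotent_completion G) :
  `[< is_compatible (fun n => component p n * component q n) >].
Proof.
by apply/asboolP => n; rewrite quotient_mapM ?componentP //; exact: gammaS.
Qed.

Lemma completion_one_subproof (G : groupType) :
  `[< is_compatible (fun n => 1 : quotient_group (gamma G n)) >].
Proof. by apply/asboolP => n; apply: quotient_mapE; exact: gammaS. Qed.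

Lemma completion_inv_subproof (G : groupType) (p : pronilpotent_completion G) :
  `[< is_compatible (fun n => (component p n)^-1) >].
Proof.
apply/asboolP => n; apply: (@mulgI _ (component p n)).
rewrite mulgV -{1}componentP -quotient_mapM ?mulgV; last exact: gammaS.
by apply: quotient_mapE; exact: gammaS.
Qed.

Definition completion_mul (G : groupType) (p q : pronilpotent_completion G) :
  pronilpotent_completion G :=
  exist (fun q => `[< is_compatible q >]) (fun n => component p n * component q n)
    (completion_mul_subproof p q).

Definition completion_one (G : groupType) : pronilpotent_completion G :=
  
  exist (fun q => `[< is_compatible q >]) (fun=> 1)
    (completion_one_subproof G).

Definition completion_inv (G : groupType) (p : pronilpotent_completion G) :
  pronilpotent_completion G :=
  exist (fun q => `[< is_compatible q >]) (fun n => (component p n)^-1)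
    (completion_inv_subproof p).

Lemma completion_mulA (G : groupType) : associative (@completion_mul G).
Proof. by move=> p q r; apply: completion_eq => n; apply: mulgA. Qed.

Lemma completion_mul1q (G : groupType) :
  left_id (completion_one G) (@completion_mul G).
Proof. by move=> p; apply: completion_eq => n; apply: mul1g. Qed.

Lemma completion_mulq1 (G : groupType) :
  right_id (completion_one G) (@completion_mul G).
Proof. by move=> p; apply: completion_eq => n; apply: mulg1. Qed.

Lemma completion_mulVq (G : groupType) :
  left_inverse (completion_one G) (@completion_inv G) (@completion_mul G).
Proof. by move=> p; apply: completion_eq => n; apply: mulVg. Qed.

Lemma completion_mulqV (G : groupType) :
  right_inverse (completion_one G) (@completion_inv G) (@completion_mul G).
Proof. by move=> p; apply: completion_eq => n; apply: mulgV. Qed.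

HB.instance Definition _ (G : groupType) :=
  isGroup.Build (pronilpotent_completion G) (@completion_mulA G)
    (@completion_mul1q G) (@completion_mulq1 G) (@completion_mulVq G)
    (@completion_mulqV G).

(* Main.v *)
(* Let c be the class of G', put A_0 = G and A_i = gamma_i(G') for i >= 1, and let
   N_i be the closure of A_i in the completion, so that N_(c+1) = 1. A finite
   subset of N_i lies, modulo N_(i+1), in a finitely generated subgroup that is
   invariant under the whole completion: the completion acts on N_i / N_(i+1)
   through G / G', because every element is congruent to one of G modulo N_1 and
   [N_i, N_1] <= N_(i+1); and the image of Z[G] in End(A_i / A_(i+1)) is a finitely
   generated abelian group, a fact that passes to N_i / N_(i+1) componentwise.
   Finitely many elements of the completion can therefore be placed in a
   polycyclic subgroup, one layer N_i at a time. *)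
Require Import Defs.
From mathcomp Require Import all_boot.
From mathcomp Require Import boolp classical_sets cardinality.

Set Implicit Arguments.
Unset Strict Implicit.
Unset Printing Implicit Defensive.

Local Open Scope classical_set_scope.
Local Open Scope group_scope.

(** * Generated subgroups, cyclic subgroups and normalizers *)

Lemma gen_min (G : groupType) (A B : set G) :
  is_subgroup B -> A `<=` B -> gen A `<=` B.
Proof. exact: smallest_sub. Qed.

Lemma gen_ind (G : groupType) (A P : set G) :
    P 1 -> (forall x y, P x -> P y -> P (x * y)) -> (forall x, P x -> P x^-1) ->
    (forall x, A x -> P x) ->
  forall x, gen A x -> P x.
Proof. by move=> P1 PM PV AP; apply: gen_min. Qed.

Lemma gen1 (G : groupType) (A : set G) : gen A 1.
Proof. by have [] := gen_subgroup A. Qed.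

Lemma genM (G : groupType) (A : set G) (x y : G) :
  gen A x -> gen A y -> gen A (x * y).
Proof. by have [_ h _] := gen_subgroup A; apply: h. Qed.

Lemma genV (G : groupType) (A : set G) (x : G) : gen A x -> gen A x^-1.
Proof. by have [_ _ h] := gen_subgroup A; apply: h. Qed.

Lemma gen_sub (G : groupType) (A : set G) : A `<=` gen A.
Proof. exact: sub_gen_smallest. Qed.

Lemma genS (G : groupType) (A B : set G) : A `<=` B -> gen A `<=` gen B.
Proof.
by move=> AB; apply: gen_min (gen_subgroup B) _ => x /AB /gen_sub.
Qed.

Lemma gen_id (G : groupType) (A : set G) : is_subgroup A -> gen A = A.
Proof.
by move=> sA; apply/seteqP; split; [apply: gen_min | apply: gen_sub].
Qed.

Lemma gen_genU (G : groupType) (A B : set G) : gen (gen A `|` B) = gen (A `|` B).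
Proof.
apply/seteqP; split; last by apply: genS => x [/gen_sub|]; [left|right].
apply: gen_min (gen_subgroup _) _ => x [|Bx]; last by apply: gen_sub; right.
by apply: genS; left.
Qed.

Lemma subgroupI (G : groupType) (A B : set G) :
  is_subgroup A -> is_subgroup B -> is_subgroup (A `&` B).
Proof.
move=> [a1 aM aV] [b1 bM bV]; split=> // [x y [? ?] [? ?]|x [? ?]].
  by split; [apply: aM|apply: bM].
by split; [apply: aV|apply: bV].
Qed.

Lemma cycleP (G : groupType) (g h : G) : gen [set g] h ->
  exists k, h = g ^+ k \/ h = (g ^+ k)^-1.
Proof.
have mix a b : exists k,
    g ^+ a / g ^+ b = g ^+ k \/ g ^+ a / g ^+ b = (g ^+ k)^-1.
  have [ba|/ltnW ab] := leqP b a.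
    by exists (a - b)%N; left; rewrite expgnFr.
  by exists (b - a)%N; right; rewrite expgnFr // invgF.
have sw a b : (g ^+ b)^-1 * g ^+ a = g ^+ a / g ^+ b.
  by symmetry; apply: (commuteV (commuteX2 a b (commute_refl g))).
move: h; apply: gen_ind => [|_ _ [a [->|->]] [b [->|->]]|_ [a [->|->]]|_ ->].
- by exists 0%N; left.
- by exists (a + b)%N; left; rewrite expgnDr.
- exact: mix.
- by rewrite sw; apply: mix.
- by exists (b + a)%N; right; rewrite expgnDr invgM.
- by exists a; right.
- by exists a; left; rewrite invgK.
- by exists 1%N; left.
Qed.

(** Both [y] and [y^-1] are required: in an infinite group [V ^ y] may be a proper subset of [V]. *)
Definition normalizer (G : groupType) (V : set G) : set G :=
  [set y | forall x, V x -> V (x ^ y) /\ V (x ^ y^-1)].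

Lemma normalizer_subgroup (G : groupType) (V : set G) :
  is_subgroup (normalizer V).
Proof.
split=> [x|x y nx ny z Vz|x nx z Vz]; rewrite ?invg1 ?conjg1 ?invgK //.
  rewrite invgM !conjgM; split.
    by have [/ny[]] := nx z Vz.
  by have [_ /nx[]] := ny z Vz.
by have [] := nx z Vz.
Qed.

Lemma sub_normalizer (G : groupType) (V : set G) :
  is_subgroup V -> V `<=` normalizer V.
Proof.
move=> [_ vM vV] y Vy x Vx; have Vy' := vV _ Vy.
by rewrite !conjgE invgK; split; do 2!apply: (vM) => //.
Qed.

Lemma normalizer_gen (G : groupType) (A : set G) (y : G) :
  (forall x, A x -> gen A (x ^ y) /\ gen A (x ^ y^-1)) -> normalizer (gen A) y.
Proof.
have aux z : (forall x, A x -> gen A (x ^ z)) ->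
    forall x, gen A x -> gen A (x ^ z).
  move=> Az; apply: gen_ind => [|u v|u|x /Az //].
  - by rewrite conj1g; apply: gen1.
  - by rewrite conjMg; apply: genM.
  - by rewrite conjVg; apply: genV.
by move=> Ay x Vx; split; apply: aux => // u /Ay [].
Qed.

Lemma genU_cycle (G : groupType) (V : set G) (g x : G) :
    is_subgroup V -> normalizer V g -> gen (V `|` [set g]) x ->
  exists2 h, gen [set g] h & V (h^-1 * x).
Proof.
move=> sV ng; have [v1 vM vV] := sV.
have cn h : gen [set g] h -> normalizer V h.
  by apply: gen_min (normalizer_subgroup V) _ h => _ ->.
move: x; apply: gen_ind => [|u v [h gh Vh] [k gk Vk]|u [h gh Vh]|y [Vy|->]].
- by exists 1; [apply: gen1|rewrite invg1 mul1g].
- exists (h * k); first exact: genM.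
  (* The power of [g] is moved to the left: [(h * k)^-1 * (u * v) = (h^-1 * u) ^ k * (k^-1 * v)]. *)
  have [+ _] := cn k gk _ Vh; move/vM => /(_ _ Vk).
  by rewrite conjgE invgM !mulgA !mulgK.
- exists h^-1; first exact: genV.
  have [_ /vV] := cn h gh _ Vh.
  by rewrite conjgE invgK -mulgA mulVKg invgM invgK.
- by exists 1; [apply: gen1|rewrite invg1 mul1g].
- by exists g; [apply: gen_sub|rewrite mulVg].
Qed.

Lemma genU_sub_normalizer (G : groupType) (V : set G) (g : G) :
    is_subgroup V -> normalizer V g -> gen (V `|` [set g]) `<=` normalizer V.
Proof.
move=> sV ng; apply: gen_min (normalizer_subgroup V) _ => x [|->//].
exact: sub_normalizer.
Qed.

(** A subgroup of a cyclic group is cyclic, read modulo [V]: [y] is an element of [K] congruent to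
    the least positive power of [g] that [K] meets modulo [V]. *)
Lemma cyclic_mod_sub (G : groupType) (V K : set G) (g : G) :
    is_subgroup V -> is_subgroup K -> normalizer V g ->
    K `<=` gen (V `|` [set g]) ->
  exists2 y, K y &
    forall x, K x -> exists2 h, gen [set y] h & V (h^-1 * x).
Proof.
move=> sV sK ng KH; have [v1 vM vV] := sV; have [k1 kM kV] := sK.
have cn h : gen [set g] h -> normalizer V h.
  by apply: gen_min (normalizer_subgroup V) _ h => _ ->.
have cX k : gen [set g] (g ^+ k).
  elim: k => [|k IH]; first exact: gen1.
  by rewrite expgS; apply: genM => //; apply: gen_sub.
(* Nonnegative exponents suffice: if [x] is congruent to a negative power of [g], then [x^-1] is
   congruent to a positive one. *)
suff [y Ky hy] : exists2 y, K y & forall k x, K x -> V ((g ^+ k)^-1 * x) ->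
    exists2 h, gen [set y] h & V (h^-1 * x).
  exists y => // x Kx.
  have [h /cycleP [k [->|->]] Vhx] := genU_cycle sV ng (KH x Kx).
    exact: hy Vhx.
  have /(hy k _ (kV _ Kx)) [l yl Vl] : V ((g ^+ k)^-1 * x^-1).
    have [+ _] := cn _ (cX k) _ (vV _ Vhx).
    by rewrite conjgE invgM !invgK mulgVK.
  exists l^-1; first exact: genV.
  have nl : normalizer V l.
    apply: gen_min (normalizer_subgroup V) _ _ yl => _ ->.
    exact: genU_sub_normalizer sV ng _ (KH _ Ky).
  have [_ /vV] := nl _ Vl.
  by rewrite conjgE invgK -mulgA mulVKg invgM !invgK.
(* If [K] meets no positive power of [g] modulo [V], only [k = 0] can occur and [y = 1] works. *)
have [ex|nex] :=
    pselect (exists d, `[< exists2 y, K y & V ((g ^+ d.+1)^-1 * y) >]); last first.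
  exists 1 => // -[|k] x Kx Vx; last first.
    by case: nex; exists k; apply/asboolP; exists x.
  by exists 1; [apply: gen1|rewrite expg0 in Vx].
have [d /asboolP [y Ky Vy] dmin] := ex_minnP ex.
(* Euclidean division by repeated subtraction: [x] becomes [y^-1 * x] and [k] drops by [d.+1]; a
   remainder below [d.+1] is 0 by minimality. *)
exists y => // k; elim/ltn_ind: k => k IH x Kx Vx.
have [dk|kd] := leqP d.+1 k; last first.
  case: k kd Vx {IH} => [|k] kd Vx.
    by exists 1; [apply: gen1|rewrite expg0 in Vx].
  suff : (d <= k)%N by rewrite leqNgt -ltnS kd.
  by apply: dmin; apply/asboolP; exists x.
have [|||h yh Vh] := IH (k - d.+1)%N _ (y^-1 * x).
- by rewrite ltn_subrL /=; apply: leq_trans dk.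
- by apply: kM => //; apply: kV.
- have [+ _] := cn _ (cX (k - d.+1)%N) _ (vV _ Vy).
  move=> /vM /(_ Vx).
  rewrite conjgE invgM invgK -!mulgA.
  suff -> : g ^+ d.+1 * (g ^+ (k - d.+1) * ((g ^+ k)^-1 * x)) = x by [].
  by rewrite mulgA -expgnDr subnKC // mulVKg.
- exists (y * h); first by apply: genM => //; apply: gen_sub.
  by rewrite invgM -mulgA.
Qed.

(** * Polycyclic subgroups by successive cyclic extensions *)

(** An inductive form of [polycyclic], shown equivalent to it below; it replaces indexed series by
    structural induction. *)
Inductive pc (G : groupType) : set G -> Prop :=
| pc1 : pc [set 1]
| pcS V g : pc V -> normalizer V g -> pc (gen (V `|` [set g])).

Lemma subgroup1 (G : groupType) : is_subgroup [set 1 : G].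
Proof. by split=> [|_ _ -> ->|_ ->] //=; rewrite ?mulg1 ?invg1. Qed.

Lemma pc_subgroup (G : groupType) (H : set G) : pc H -> is_subgroup H.
Proof. by case=> *; [apply: subgroup1|apply: gen_subgroup]. Qed.

Lemma cyclic_quotient_gen (G : groupType) (V K : set G) (y : G) :
    is_subgroup V -> is_subgroup K -> V `<=` K -> K y ->
    (forall x, K x -> exists2 h, gen [set y] h & V (h^-1 * x)) ->
  K = gen (V `|` [set y]).
Proof.
move=> sV sK VK Ky cK; apply/seteqP; split=> [x /cK [h yh Vh]|]; last first.
  by apply: gen_min => // x [/VK|->].
rewrite -(mulVKg h x); apply: genM; last by apply: gen_sub; left.
by apply: genS yh; right.
Qed.

Lemma pc_polycyclic (G : groupType) (H : set G) : pc H -> polycyclic H.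
Proof.
elim=> [|V g pV [n [S [S0 Sn sV Si]]] ng].
  by exists 0%N, (fun=> [set 1]); split=> //; exact: subgroup1.
exists n.+1, (fun i => if (i <= n)%N then S i else gen (V `|` [set g])).
split; rewrite ?ltnn ?leq0n //; first exact: gen_subgroup.
move=> i; rewrite ltnS => lin; rewrite lin; case: ltngtP lin => // [lin _|-> _].
  exact: Si.
rewrite Sn; split.
  split=> // [x Vx|x y Vx Hy]; first by apply: gen_sub; left.
  by have [] := genU_sub_normalizer sV ng Hy Vx.
exists g; first by apply: gen_sub; right.
by move=> x; apply: genU_cycle.
Qed.

Lemma polycyclic_pc (G : groupType) (H : set G) : polycyclic H -> pc H.
Proof.
move=> [n [S [S0 <- sH Si]]].
suff h i : (i <= n)%N -> pc (S i) by apply: h.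
elim: i => [|i IH] lin; first by rewrite S0; exact: pc1.
have [[sS SS nS] [g Sg cg]] := Si i lin.
(* Below the top, a term is a subgroup because it is normal in the next one; the top term is [H]. *)
have sS' : is_subgroup (S i.+1).
  case: (ltngtP i.+1 n) lin => // [lin _|-> _].
    by have [[]] := Si _ lin.
  exact: sH.
rewrite (cyclic_quotient_gen sS sS' SS Sg cg); apply: pcS (IH (ltnW lin)) _.
move=> x Sx; split; apply: nS => //.
by have [_ _] := sS'; apply.
Qed.

(** Induction on the extension: [V] meets [K] in a polycyclic group, and the quotient of [K] by it
    embeds into the cyclic quotient of [H] by [V]. *)
Lemma pc_sub (G : groupType) (H K : set G) :
  pc H -> is_subgroup K -> K `<=` H -> pc K.
Proof.
move=> pH; elim: pH K => [|V g pV IH ng] K sK KH.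
  suff -> : K = [set 1] by exact: pc1.
  by apply/seteqP; split=> // _ ->; case: sK.
have sV := pc_subgroup pV.
have [y Ky cy] := cyclic_mod_sub sV sK ng KH.
have [_ kM kV] := sK.
have sVK : is_subgroup (V `&` K) by exact: subgroupI.
rewrite (@cyclic_quotient_gen _ (V `&` K) K y) //; last first.
  move=> x Kx; have [h yh Vh] := cy x Kx; exists h => //; split=> //.
  by apply: kM => //; apply: kV; apply: gen_min yh => // _ ->.
apply: pcS; first by apply: IH => // x [].
move=> x [Vx Kx].
have [] := genU_sub_normalizer sV ng (KH _ Ky) Vx.
by have [] := sub_normalizer sK Ky Kx.
Qed.

Lemma pc_finitely_generated (G : groupType) (H : set G) :
  pc H -> finitely_generated H.
Proof.
elim=> [|V g _ [X fX ->] _].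
  by exists [set 1]; [exact: finite_set1|rewrite gen_id //; exact: subgroup1].
by exists (X `|` [set g]); [rewrite finite_setU|rewrite gen_genU].
Qed.

(** * Assembling polycyclic subgroups along a descending chain *)

(** The elements of [s] are adjoined one at a time; as they commute modulo [V], each normalizes what
    the others generate with [V]. *)
Lemma pc_extend (G : groupType) (V : set G) (s : seq G) :
    pc V -> (forall f, f \in s -> normalizer V f) ->
    (forall f f', f \in s -> f' \in s -> V [~ f, f']) ->
  pc (gen (V `|` [set` s])).
Proof.
move=> pV; have sV := pc_subgroup pV; have [v1 vM vV] := sV.
elim: s => [_ _|f s IH sn sc].
  suff -> : V `|` [set` [::]] = V by rewrite gen_id.
  by apply/seteqP; split=> x; [case|left].
have -> : gen (V `|` [set` f :: s]) = gen (gen (V `|` [set` s]) `|` [set f]).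
  rewrite gen_genU; congr gen; apply/seteqP; split=> x /=.
    case=> [Vx|]; first by do 2!left.
    by rewrite inE => /orP [/eqP ->|xs]; [right|left; right].
  by case=> [[|xs]|->]; [left|right; rewrite inE xs orbT|right; rewrite inE eqxx].
apply: pcS.
  apply: IH => [g gs|g g' gs gs']; [apply: sn|apply: sc];
    by rewrite inE ?gs ?gs' orbT.
have nf : normalizer V f by apply: sn; rewrite inE eqxx.
apply: normalizer_gen => x [Vx|/= xs].
  by have [] := nf x Vx; split; apply: gen_sub; left.
have Vc : V [~ x, f] by apply: sc; rewrite inE ?xs ?orbT ?eqxx.
(* [[~ x, f^-1]] is the conjugate of [[~ x, f]^-1] by [f^-1]. *)
have Vc' : V [~ x, f^-1].
  have [_] := nf _ (vV _ Vc).
  by rewrite commgEl invgM invgK conjMg conjVg conjgK -commgEl.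
split; rewrite -[_ ^ _](mulVKg x) -commgEl; apply: genM.
- by apply: gen_sub; right.
- by apply: gen_sub; left.
- by apply: gen_sub; right.
- by apply: gen_sub; left.
Qed.

(* Downward induction on i, enlarging rather than presenting: the generators of
   a finitely generated G-invariant subgroup of N i modulo N i.+1 satisfy the
   relations expressing commutation and invariance only up to finitely many
   errors in N i.+1, and those errors are put into the subgroup of N i.+1
   obtained by induction. *)
Lemma chain_locally_polycyclic (G : groupType) (N : nat -> set G) (n : nat) :
    N 0%N = [set: G] -> N n `<=` [set 1] ->
    (forall i x y, N i x -> N i y -> N i.+1 [~ x, y]) ->
    (forall i E, finite_set E -> E `<=` N i -> exists F, [/\ finite_set F,
       E `<=` F, F `<=` N i & forall f c, F f ->
       exists2 h, gen F h & N i.+1 (h^-1 * f ^ c)]) ->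
  locally_polycyclic G.
Proof.
move=> N0 Nn Ncomm Nfin.
(* Invariance under an arbitrary finite [C] is added to the claim so that the generators chosen in
   one layer normalize the subgroup obtained from the next. *)
suff claim k : forall i, (i + k)%N = n -> forall C E : set G,
    finite_set C -> finite_set E -> E `<=` N i ->
    exists U, [/\ pc U, E `<=` U & forall c x, C c -> U x -> U (x ^ c)].
  move=> H sH [E fE HE]; have [||U [pU EU _]] := claim n 0%N erefl set0 E _ fE _.
  - exact: finite_set0.
  - by rewrite N0.
  - apply/pc_polycyclic/(pc_sub pU sH).
    by rewrite HE; apply: gen_min (pc_subgroup pU) EU.
elim: k => [|k IH] i ik C E fC fE EN.
  exists [set 1]; split; first exact: pc1.
    by apply: subset_trans EN _; rewrite -(addn0 i) ik.
  by move=> c x _ ->; apply: conj1g.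
have [F [fF EF FN Fc]] := Nfin i E fE EN.
have /choice [h hP] : forall p : G * G, exists h, F p.1 ->
    gen F h /\ N i.+1 (h^-1 * p.1 ^ p.2).
  move=> [f c] /=; have [Ff|nFf] := pselect (F f); last by exists 1.
  by have [h] := Fc f c Ff; exists h.
(* [E1] collects the errors of invariance, [E2] those of commutation; [C'] includes [F] and its
   inverses so that [F] normalizes [U]. *)
pose E1 := (fun p : G * G => (h p)^-1 * p.1 ^ p.2) @` (F `*` C).
pose E2 := (fun p : G * G => [~ p.1, p.2]) @` (F `*` F).
pose C' := C `|` (F `|` [set f^-1 | f in F]).
have [||||U [pU EU UC]] := IH i.+1 _ C' (E1 `|` E2).
- by rewrite addSnnS.
- by rewrite !finite_setU; do !split => //; apply: finite_image.
- by rewrite finite_setU; split; apply: finite_image; apply: finite_setX.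
- move=> _ [[[f c] [/= Ff _] <-]|[[f f'] [/= Ff Ff'] <-]].
    by have [] := hP (f, c) Ff.
  by apply: Ncomm; apply: FN.
have [s sF] : exists s : seq G, F = [set` s] by apply/finite_seqP.
exists (gen (U `|` F)); split.
- rewrite sF; apply: pc_extend => // [f fs|f f' fs fs'].
    have Ff : F f by rewrite sF.
    move=> x Ux; split; apply: UC => //; right; [by left|right].
    by exists f.
  by apply: EU; right; exists (f, f') => //; rewrite sF.
- by move=> x /EF Fx; apply: gen_sub; right.
move=> c + Cc; apply: gen_ind => [|x y Ux Uy|x Ux|x [Ux|Fx]].
- by rewrite conj1g; apply: gen1.
- by rewrite conjMg; apply: genM.
- by rewrite conjVg; apply: genV.
- by apply: gen_sub; left; apply: UC => //; left.
- rewrite -(mulVKg (h (x, c)) (x ^ c)); apply: genM.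
    have [+ _] := hP (x, c) Fx.
    by apply: genS; right.
  by apply: gen_sub; left; apply: EU; left; exists (x, c).
Qed.

(** * Homomorphisms and subgroups of quotients *)

Lemma hom1 (G H : groupType) (f : G -> H) : {morph f : x y / x * y} -> f 1 = 1.
Proof. by move=> fM; apply: (mulgI (f 1)); rewrite -fM !mulg1. Qed.

Lemma homV (G H : groupType) (f : G -> H) :
  {morph f : x y / x * y} -> {morph f : x / x^-1}.
Proof. by move=> fM x; apply: (mulgI (f x)); rewrite -fM !mulgV hom1. Qed.

Lemma homJ (G H : groupType) (f : G -> H) :
  {morph f : x y / x * y} -> {morph f : x y / x ^ y}.
Proof. by move=> fM x y; rewrite !conjgE !fM homV. Qed.

Lemma homR (G H : groupType) (f : G -> H) :
  {morph f : x y / x * y} -> {morph f : x y / [~ x, y]}.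
Proof. by move=> fM x y; rewrite !commgEl fM homV // homJ. Qed.

Lemma gen_image (G H : groupType) (f : G -> H) (X : set G) :
  {morph f : x y / x * y} -> f @` gen X = gen (f @` X).
Proof.
move=> fM; apply/seteqP; split=> [_ [x + <-]|].
  move: x; apply: gen_ind => [|x y ? ?|x ?|x Xx].
  - by rewrite hom1 //; apply: gen1.
  - by rewrite fM; apply: genM.
  - by rewrite homV //; apply: genV.
  - by apply: gen_sub; exists x.
apply: gen_ind => [|_ _ [x gx <-] [y gy <-]|_ [x gx <-]|_ [x Xx <-]].
- by exists 1; [apply: gen1|apply: hom1].
- by exists (x * y); [apply: genM|apply: fM].
- by exists x^-1; [apply: genV|apply: homV].
- by exists x => //; apply: gen_sub.
Qed.

(** The preimage of [K] is a subgroup of a polycyclic group, hence finitely generated, and it maps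
    onto [K]. *)
Lemma quotient_subgroup_finitely_generated (G : groupType)
    (N : normal_subgroup G) (K : set (quotient_group N)) :
  pc [set: G] -> is_subgroup K -> finitely_generated K.
Proof.
move=> pG [k1 kM kV]; have cM := @cosetM G N.
have sP : is_subgroup [set x | K (coset N x)].
  split=> [|x y /= ? ?|x /= ?]; first by rewrite /= hom1.
    by rewrite cM; apply: kM.
  by rewrite (homV cM); apply: kV.
have [X fX PX] := pc_finitely_generated (pc_sub pG sP (@subsetT _ _)).
exists (coset N @` X); first exact: finite_image.
rewrite -gen_image // -PX; apply/seteqP; split=> [q Kq|_ [x Kx <-] //].
by exists (repr q); rewrite /= coset_repr.
Qed.

(** * Group-ring words acting by conjugation *)

(* Elements of the group ring Z[G], written multiplicatively: a word acts on a
   group on which G acts by conjugation, and the action is additive only on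
   abelian sections. *)
Inductive word (G : Type) :=
  WOne | WConj of G | WMul of word G & word G | WInv of word G.
Arguments WOne {G}.

Fixpoint weval (G : Type) (H : groupType) (f : G -> H) (w : word G) (x : H) : H :=
  match w with
  | WOne => 1
  | WConj g => x ^ f g
  | WMul u v => weval f u x * weval f v x
  | WInv u => (weval f u x)^-1
  end.

Lemma hom_weval (G : Type) (H K : groupType) (f : G -> H) (h : H -> K) w x :
  {morph h : x y / x * y} -> h (weval f w x) = weval (h \o f) w (h x).
Proof.
move=> hM; elim: w => [|g|u IHu v IHv|u IHu] /=.
- exact: hom1.
- exact: homJ.
- by rewrite hM IHu IHv.
- by rewrite homV // IHu.
Qed.

(** Right multiplication by [g] in the group ring. *)
Fixpoint wconj (G : groupType) (w : word G) (g : G) : word G :=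
  match w with
  | WOne => WOne
  | WConj h => WConj (h * g)
  | WMul u v => WMul (wconj u g) (wconj v g)
  | WInv u => WInv (wconj u g)
  end.

Lemma weval_conj (G H : groupType) (f : G -> H) w g x :
  {morph f : x y / x * y} -> weval f (wconj w g) x = weval f w x ^ f g.
Proof.
move=> fM; elim: w => [|h|u IHu v IHv|u IHu] /=.
- by rewrite conj1g.
- by rewrite fM conjgM.
- by rewrite IHu IHv conjMg.
- by rewrite IHu conjVg.
Qed.

Inductive wspan (G : Type) (T : set (word G)) : word G -> Prop :=
| wspan1 : wspan T WOne
| wspan_sub w : T w -> wspan T w
| wspanM u v : wspan T u -> wspan T v -> wspan T (WMul u v)
| wspanV u : wspan T u -> wspan T (WInv u).

Lemma wspanS (G : Type) (S T : set (word G)) :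
  S `<=` T -> wspan S `<=` wspan T.
Proof.
move=> ST w; elim=> *;
  by [apply: wspan1|apply/wspan_sub/ST|apply: wspanM|apply: wspanV].
Qed.

Lemma wspan_weval (G : Type) (H : groupType) (f : G -> H) T (X : set H) w x :
    is_subgroup X -> (forall u, T u -> X (weval f u x)) -> wspan T w ->
  X (weval f w x).
Proof.
move=> [X1 XM XV] TX; elim=> //= [u v _ Xu _ Xv|u _ Xu].
- exact: XM.
- exact: XV.
Qed.

Section AbelianSection.
Variables (G : Type) (H : groupType) (f : G -> H) (A : set H).
Hypotheses (sA : is_subgroup A) (cA : forall x y, A x -> A y -> x * y = y * x).
Hypothesis (nA : forall g x, A x -> A (x ^ f g)).

Lemma weval_stable w x : A x -> A (weval f w x).
Proof.
have [A1 AM AV] := sA => Ax.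
elim: w => //= [g|u IHu v IHv|u IHu]; [exact: nA|exact: AM|exact: AV].
Qed.

Lemma wevalM w x y : A x -> A y -> weval f w (x * y) = weval f w x * weval f w y.
Proof.
have [A1 AM AV] := sA => Ax Ay.
elim: w => /= [|g|u IHu v IHv|u IHu].
- by rewrite mulg1.
- exact: conjMg.
- rewrite IHu IHv -!mulgA; congr (_ * _); rewrite !mulgA; congr (_ * _).
  by apply: cA; apply: weval_stable.
- by rewrite IHu invgM; apply: cA; apply: AV; apply: weval_stable.
Qed.

Lemma weval1 w : weval f w 1 = 1.
Proof.
by elim: w => //= [g|u -> v ->|u ->]; rewrite ?conj1g ?mulg1 ?invg1.
Qed.

Lemma wevalV w x : A x -> weval f w x^-1 = (weval f w x)^-1.
Proof.
move=> Ax; apply: (mulgI (weval f w x)).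
by rewrite -wevalM ?mulgV ?weval1 //; have [_ _] := sA; apply.
Qed.

(* The ring of endomorphisms of a finitely generated abelian group M generated
   by a group action is a finitely generated abelian group, since evaluation at
   the generators embeds it into a power of M; the induction adds one generator
   of M at a time. *)
Lemma word_ring_finitely_generated :
    (forall K, is_subgroup K -> K `<=` A -> finitely_generated K) ->
  exists2 T : set (word G), finite_set T &
    forall w, exists2 w', wspan T w' &
      forall a, A a -> weval f w a = weval f w' a.
Proof.
have [A1 AM AV] := sA.
move=> noethA; have [X fX AX] := noethA A sA (@subset_refl _ A).
have [s sX] : exists s : seq H, X = [set` s] by apply/finite_seqP.
have sAX a : a \in s -> A a by move=> xs; rewrite AX sX; apply: gen_sub.
(* Words act on [A] as endomorphisms, so agreement on the generators [s] is enough. *)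
suff [T fT hT] : exists2 T : set (word G), finite_set T &
    forall w, exists2 w', wspan T w' &
      forall a, a \in s -> weval f w a = weval f w' a.
  exists T => // w; have [w' Tw' ww'] := hT w; exists w' => // a Aa.
  have : gen X a by rewrite -AX.
  suff h b : gen X b -> A b /\ weval f w b = weval f w' b by case/h.
  move: b; apply: gen_ind => [|x y [Ax ex] [Ay ey]|x [Ax ex]|x].
  - by rewrite !weval1.
  - by split; [apply: AM|rewrite !wevalM // ex ey].
  - by split; [apply: AV|rewrite !wevalV // ex].
  - by rewrite sX => /= xs; split; [apply: sAX|apply: ww'].
elim: s sAX {sX} => [_|a s IH sAX].
  by exists set0; [exact: finite_set0|move=> w; exists WOne => //; exact: wspan1].
have [|T fT hT] := IH; first by move=> b bs; apply: sAX; rewrite inE bs orbT.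
have Aa : A a by apply: sAX; rewrite inE eqxx.
(* Words that kill the earlier generators; their values at the new generator [a] form a subgroup of
   [A], finitely generated by [noethA]. *)
pose Ann := [set w | forall b, b \in s -> weval f w b = 1].
pose K := (weval f)^~ a @` Ann.
have [||Y fY KY] := noethA K.
- split=> [|_ _ [u hu <-] [v hv <-]|_ [u hu <-]].
  + by exists WOne.
  + by exists (WMul u v) => // b bs /=; rewrite hu // hv // mulg1.
  + by exists (WInv u) => // b bs /=; rewrite hu // invg1.
- by move=> _ [w _ <-]; apply: weval_stable.
have /choice [r rP] : forall y, exists w, Y y -> Ann w /\ weval f w a = y.
  move=> y; have [Yy|nYy] := pselect (Y y); last by exists WOne.
  have : K y by rewrite KY; apply: gen_sub.
  by case=> w hw <-; exists w.
exists (T `|` r @` Y); first by rewrite finite_setU; split=> //; apply: finite_image.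
move=> w; have [w1 Tw1 e1] := hT w.
have KYgen : gen Y `<=` (weval f)^~ a @` (wspan (r @` Y) `&` Ann).
  apply: gen_ind => [|_ _ [u [su hu] <-] [v [sv hv] <-]|_ [u [su hu] <-]|y Yy].
  - by exists WOne => //; split => //; apply: wspan1.
  - exists (WMul u v) => //; split; first exact: wspanM.
    by move=> b bs /=; rewrite hu // hv // mulg1.
  - exists (WInv u) => //; split; first exact: wspanV.
    by move=> b bs /=; rewrite hu // invg1.
  - have [ry ya] := rP y Yy; exists (r y) => //; split=> //.
    by apply: wspan_sub; exists y.
(* The difference of [w] and [w1] lies in [Ann]; [w2] has the same value at [a] and also kills [s],
   so it corrects [w1] at [a] only. *)
have [|w2 [s2 h2] e2] := KYgen (weval f (WMul w (WInv w1)) a).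
  by rewrite -KY; exists (WMul w (WInv w1)) => // b bs /=; rewrite e1 // mulgV.
exists (WMul w2 w1).
  by apply: wspanM; [apply: wspanS s2|apply: wspanS Tw1] => x; [right|left].
move=> b; rewrite inE => /orP [/eqP ->|bs] /=; first by rewrite e2 /= mulgVK.
by rewrite h2 // mul1g e1.
Qed.

End AbelianSection.

(** * The lower central series of the derived subgroup and its closure in the completion *)

Lemma lcs_normal_in (G : groupType) (H : set G) (n : nat) :
  is_normal_in H [set: G] -> is_normal_in (lcs H n) [set: G].
Proof.
move=> nH; have [_ _ HJ] := nH.
elim: n => [//|n [_ _ IH]]; split=> //; first exact: gen_subgroup.
move=> x y Lx _; move: x Lx; apply: gen_conj => _ [a [b [La Hb ->]]].
by exists (a ^ y), (b ^ y); split; [apply: IH|apply: HJ|rewrite conjRg].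
Qed.

Lemma lcsS_sub (G : groupType) (H : set G) (n : nat) :
  is_normal_in H [set: G] -> lcs H n.+1 `<=` lcs H n.
Proof.
move=> nH; have [sL _ LJ] := lcs_normal_in n nH; have [_ LM LV] := sL.
apply: gen_min => // _ [x [y [Lx _ ->]]]; rewrite commgEl.
by apply: LM; [apply: LV|apply: LJ].
Qed.

Lemma lcs_sub (G : groupType) (H : set G) (n : nat) :
  is_normal_in H [set: G] -> lcs H n `<=` H.
Proof.
by move=> nH; elim: n => [//|n IH] x /(lcsS_sub nH) /IH.
Qed.

Section Completion.
Variable G : groupType.

Lemma derived_normal : is_normal_in (derived G) [set: G].
Proof. exact: (@lcs_normal G 1). Qed.

Definition series (i : nat) : set G :=
  if i is j.+1 then lcs (derived G) j else [set: G].

Lemma series_normal_in i : is_normal_in (series i) [set: G].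
Proof. by case: i => [//|i]; apply: lcs_normal_in derived_normal. Qed.

Definition nseries (i : nat) : normal_subgroup G :=
  NormalSubgroup (series_normal_in i).

Lemma series_comm_derived i x y :
  series i x -> derived G y -> series i.+1 [~ x, y].
Proof.
case: i => [|i] Sx Dy; last by apply: gen_sub; exists x, y.
by apply: gen_sub; exists x, y.
Qed.

(** This makes the factors of [series] abelian, as the action of words requires. *)
Lemma series_comm i x y : series i x -> series i y -> series i.+1 [~ x, y].
Proof.
case: i => [|i] Sx Sy; first by apply: gen_sub; exists x, y.
by apply: series_comm_derived => //; apply: lcs_sub derived_normal _ Sy.
Qed.

Local Notation Ghat := (pronilpotent_completion G).

Definition cproj (n : nat) (q : Ghat) := component q n.

Lemma cprojM n : {morph cproj n : p q / p * q}.
Proof. by []. Qed.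

Lemma diag_subproof (g : G) : `[< is_compatible (fun n => coset (gamma G n) g) >].
Proof. by apply/asboolP => n; apply: quotient_mapE; exact: gammaS. Qed.

Definition diag (g : G) : Ghat :=
  exist (fun q => `[< is_compatible q >]) (fun n => coset (gamma G n) g)
    (diag_subproof g).

Lemma diagM : {morph diag : x y / x * y}.
Proof. by move=> x y; apply: completion_eq => n; exact: cosetM. Qed.

(* The closure of A in the completion, for the topology of the inverse limit. *)
Definition closure (A : set G) : set Ghat :=
  [set q | forall n, exists2 a, A a & cproj n q = coset (gamma G n) a].

Lemma closure_comm (A B C : set G) p q :
    (forall x y, A x -> B y -> C [~ x, y]) ->
  closure A p -> closure B q -> closure C [~ p, q].
Proof.
move=> ABC Ap Bq n; have [a Aa pa] := Ap n; have [b Bb qb] := Bq n.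
exists [~ a, b]; first exact: ABC.
by rewrite (homR (@cprojM n)) pa qb (homR (@cosetM _ _)).
Qed.

Lemma closure_subgroup (N : normal_subgroup G) : is_subgroup (closure N).
Proof.
split=> [n|p q Np Nq n|p Np n].
- by exists 1; first exact: nsub1.
- have [a Na pa] := Np n; have [b Nb qb] := Nq n.
  by exists (a * b); [exact: nsubM|rewrite cprojM pa qb cosetM].
- have [a Na pa] := Np n.
  exists a^-1; first exact: nsubV.
  by rewrite (homV (@cprojM n)) pa (homV (@cosetM _ _)).
Qed.

Lemma closureJ (N : normal_subgroup G) p q : closure N p -> closure N (p ^ q).
Proof.
move=> Np n; have [a Na pa] := Np n.
exists (a ^ repr (cproj n q)); first exact: nsubJ.
by rewrite (homJ (@cprojM n)) (homJ (@cosetM _ _)) coset_repr pa.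
Qed.

(** By compatibility, descending one level at a time, a representative of component [n] also
    represents component [m]. *)
Lemma cproj_eq1 m n q : (m <= n)%N -> cproj m q = 1 ->
  gamma G m (repr (cproj n q)).
Proof.
move=> mn qm.
suff : gamma G m (1^-1 * repr (cproj n q)) by rewrite invg1 mul1g.
apply/coset_eqP.
suff -> : coset (gamma G m) (repr (cproj n q)) = cproj m q by rewrite qm.
elim: n mn {qm} => [|n IH]; first by case: m => // _; rewrite coset_repr.
rewrite leq_eqVlt => /orP [/eqP ->|]; first by rewrite coset_repr.
rewrite ltnS => mn; rewrite -(IH mn); apply/coset_eqP.
have sub k : (m <= k)%N -> gamma G k `<=` gamma G m.
  elim: k => [|k IHk]; first by case: m {mn IH}.
  rewrite leq_eqVlt => /orP [/eqP <- //|]; rewrite ltnS => mk x.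
  by move/gammaS/(IHk mk).
apply: (sub n mn); apply/coset_eqP.
by rewrite coset_repr -/(quotient_map _ _) /cproj componentP.
Qed.

Lemma diag_mod_derived (c : Ghat) :
  exists g, closure (derived G) ((diag g)^-1 * c).
Proof.
(* By the index shift, component 1 lives in the quotient of [G] by [derived G]. *)
exists (repr (cproj 1 c)); set d := _ * c.
have d1 : cproj 1 d = 1.
  by rewrite cprojM (homV (@cprojM 1)) /= [cproj 1 (diag _)]coset_repr mulVg.
move=> [|n]; last first.
  by exists (repr (cproj n.+1 d)); [exact: (cproj_eq1 _ d1)|rewrite coset_repr].
(* At level 0 the quotient is trivial, so 1 serves as representative. *)
exists 1; first exact: nsub1 (nseries 1).
by rewrite -(coset_repr (cproj 0 d)); apply/coset_eqP.
Qed.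

(** At each level [q] is represented by some [a] in [series i], where the two words differ by an
    element of [series i.+1]. *)
Lemma weval_closure i w v (q : Ghat) :
    (forall a, series i a ->
      weval (coset (nseries i.+1)) w (coset (nseries i.+1) a) =
      weval (coset (nseries i.+1)) v (coset (nseries i.+1) a)) ->
    closure (series i) q ->
  closure (series i.+1) ((weval diag w q)^-1 * weval diag v q).
Proof.
move=> wv Nq n; have [a Sa qa] := Nq n.
have ev u : cproj n (weval diag u q) = coset (gamma G n) (weval id u a).
  rewrite (hom_weval _ _ _ (@cprojM n)) (hom_weval _ _ _ (@cosetM _ _)) qa.
  by [].
exists ((weval id w a)^-1 * weval id v a).
  have := wv a Sa.
  rewrite -!(hom_weval id _ _ (@cosetM _ _)).
  by move/coset_eqP.
by rewrite cprojM (homV (@cprojM n)) !ev cosetM (homV (@cosetM _ _)).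
Qed.

(** [F] adds to [E] its images under finitely many words that additively span the action of the
    group ring on the factor; so [gen F] contains, modulo the next layer, all conjugates of [F]. *)
Lemma closure_series_finite i (E : set Ghat) :
    pc [set: G] -> finite_set E -> E `<=` closure (series i) ->
  exists F, [/\ finite_set F, E `<=` F, F `<=` closure (series i) &
    forall q c, F q -> exists2 h, gen F h & closure (series i.+1) (h^-1 * q ^ c)].
Proof.
move=> pG fE EN.
pose f := coset (nseries i.+1); pose A := f @` series i.
have fM : {morph f : x y / x * y} by exact: cosetM.
have [T fT hT] : exists2 T : set (word G), finite_set T &
    forall w, exists2 w', wspan T w' &
      forall a, A a -> weval f w a = weval f w' a.
  apply: word_ring_finitely_generated.
  - have [sS _ _] := series_normal_in i; rewrite /A -(gen_id sS) gen_image //.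
    exact: gen_subgroup.
  - move=> _ _ [a Sa <-] [b Sb <-]; rewrite -!fM; apply/coset_eqP.
    by rewrite invgM -mulgA; apply: series_comm.
  - move=> g _ [a Sa <-]; exists (a ^ g); last exact: homJ.
    exact: (@nsubJ _ (nseries i)).
  - by move=> K sK _; apply: quotient_subgroup_finitely_generated.
have sN := closure_subgroup (nseries i.+1).
have [_ NM _] := sN.
pose F := E `|` (fun p : word G * Ghat => weval diag p.1 p.2) @` (T `*` E).
have Fw q : F q -> exists2 w, True & exists2 u, E u & q = weval diag w u.
  case=> [Eq|[[w u] [/= _ Eu] <-]]; last by exists w => //; exists u.
  (* [WConj 1] acts as the identity. *)
  exists (WConj 1) => //; exists q => //=.
  by rewrite (hom1 diagM) conjg1.
have FN : F `<=` closure (series i).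
  move=> q /Fw [w _ [u Eu ->]].
  have [s1 sM sV] := closure_subgroup (nseries i).
  elim: w => //= [g|w IHw v IHv|w IHw].
  - exact: (@closureJ (nseries i)) (EN _ Eu).
  - exact: sM.
  - exact: sV.
exists F; split => //.
- by rewrite finite_setU; split=> //; apply/finite_image/finite_setX.
- by move=> q Eq; left.
move=> q c Fq; have [w _ [u Eu qw]] := Fw q Fq.
have [g Dg] := diag_mod_derived c.
have [w' Tw' ww'] := hT (wconj w g).
exists (weval diag w' u).
  apply: wspan_weval Tw'; first exact: gen_subgroup.
  by move=> v Tv; apply: gen_sub; right; exists (v, u).
set h := weval _ _ _.
(* Replacing [c] by [diag g] costs a commutator with an element of the closure of [derived G], which
   falls into the next layer. *)
have -> : h^-1 * q ^ c = (h^-1 * q ^ diag g) * [~ q ^ diag g, (diag g)^-1 * c].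
  by rewrite commgEl -conjgM mulVKg -mulgA mulVKg.
apply: NM.
  rewrite qw -weval_conj; last exact: diagM.
  apply: weval_closure (EN _ Eu) => a Sa; rewrite -ww' //.
  by exists a.
apply: closure_comm Dg; first exact: series_comm_derived.
exact: (@closureJ (nseries i)) (FN _ Fq).
Qed.

End Completion.

Theorem theorem4p4 (G : groupType) (hG : Pstar G) :
  locally_polycyclic (pronilpotent_completion G).
Proof.
have [pG _ [n nilG]] := hG.
(* The chain ends at [n.+1] since [series n.+1] is [lcs (derived G) n], which is trivial. *)
apply: (@chain_locally_polycyclic _ (fun i => closure (@series G i)) n.+1).
- apply/seteqP; split=> // q _ n'; exists (repr (cproj n' q)) => //.
  by rewrite coset_repr.
- move=> q Nq; apply: completion_eq => k; have [a] := Nq k.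
  by rewrite /= nilG => ->.
- by move=> i x y; apply: closure_comm; apply: series_comm.
- by move=> i E; apply: closure_series_finite; apply: polycyclic_pc.
Qed.
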